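(* Let $\theta\ne0,\pi$ and $\phi\ne\pm\frac{\pi}{2}$, and let $d/r\ll1$. For the special case of a uniform linear array with $M_y=1$ and $M=M_z$, the closed-form SNR $\gamma$ of the context reduces to $$\gamma=\frac{\bar PA\cos\phi}{4\pi dr\sin\theta}\left[\sin(\alpha_1(M))+\sin(\alpha_2(M))\right]=\frac{\bar PA\cos\phi}{2\pi dr\sin\theta}\sin\!\left(\frac{\Delta_{\rm span}(M)}{2}\right)\cos\!\left(\frac{\Delta_{\rm diff}(M)}{2}\right),$$ where $$\alpha_1(M)=\arctan\!\left(\frac{Md/2-r\cos\theta}{r\sin\theta}\right),\qquad \alpha_2(M)=\arctan\!\left(\frac{Md/2+r\cos\theta}{r\sin\theta}\right),$$ $\Delta_{\rm span}(M)=\alpha_1(M)+\alpha_2(M)$ and $\Delta_{\rm diff}(M)=\alpha_1(M)-\alpha_2(M)$.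
   Context: For a uniform planar array in the $y$-$z$ plane, centred at the origin, with $M_y$ elements along the $y$-axis and $M_z$ along the $z$-axis, element area $A$, spacing $d$, physical dimensions $L_y\approx M_yd$, $L_z\approx M_zd$, array occupation ratio $\xi=A/d^2\le1$ and transmit SNR $\bar P$ (transmit power over noise power), and a user at distance $r$ from the array centre with zenith angle $\theta\in[0,\pi]$ and azimuth angle $\phi\in[-\frac{\pi}{2},\frac{\pi}{2}]$, put $\Psi=\sin\theta\cos\phi$, $\Phi=\sin\theta\sin\phi$, $\Omega=\cos\theta$. The closed-form SNR with optimal single-user maximum ratio combining/transmission beamforming is $$\gamma=\frac{\xi\bar P}{4\pi}\left[U\!\left(\tfrac{L_y}{2r}-\Phi,\tfrac{L_z}{2r}-\Omega\right)+U\!\left(\tfrac{L_y}{2r}+\Phi,\tfrac{L_z}{2r}-\Omega\right)+U\!\left(\tfrac{L_y}{2r}-\Phi,\tfrac{L_z}{2r}+\Omega\right)+U\!\left(\tfrac{L_y}{2r}+\Phi,\tfrac{L_z}{2r}+\Omega\right)\right],$$ with $U(x,y)=\arctan\!\left(\dfrac{xy}{\Psi\sqrt{\Psi^2+x^2+y^2}}\right)$. In the linear-array case $L_y=d$ and $L_z=Md$ are substituted, and the reduction uses a first-order Taylor approximation in the small quantity $\epsilon=d/r$. $\Delta_{\rm span}$ is called the angular span and $\Delta_{\rm diff}$ the angular difference. *)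

(* Defs.v *)
From Stdlib Require Import Reals.
From Coquelicot Require Import Coquelicot.
Open Scope R_scope.

Definition dirPsi (theta phi : R) : R := sin theta * cos phi.
Definition dirPhi (theta phi : R) : R := sin theta * sin phi.
Definition dirOmega (theta : R) : R := cos theta.

Definition occupation (A d : R) : R := A / d ^ 2.

Definition Ufun (Psi x y : R) : R :=
  atan (x * y / (Psi * sqrt (Psi ^ 2 + x ^ 2 + y ^ 2))).

(* Closed-form SNR of a planar array with occupation ratio [xi] and physical
   dimensions [Ly], [Lz], for a user at [(r, theta, phi)]. *)
Definition snr_upa (xi Pbar Ly Lz r theta phi : R) : R :=
  let U := Ufun (dirPsi theta phi) in
  let Phi := dirPhi theta phi in
  let Omega := dirOmega theta in
  xi * Pbar / (4 * PI) *
  (U (Ly / (2 * r) - Phi) (Lz / (2 * r) - Omega) +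
   U (Ly / (2 * r) + Phi) (Lz / (2 * r) - Omega) +
   U (Ly / (2 * r) - Phi) (Lz / (2 * r) + Omega) +
   U (Ly / (2 * r) + Phi) (Lz / (2 * r) + Omega)).

Definition snr_ula (M : nat) (A d Pbar r theta phi : R) : R :=
  snr_upa (occupation A d) Pbar d (INR M * d) r theta phi.

(* The SNR of the linear array as a function of the variable [eps], which
   stands for [d / r] and enters through the width [Ly = eps * r] only.  The
   length [INR M * d] and the occupation ratio are not expanded: the number of
   elements may be large, so [INR M * d / r] need not be small. *)
Definition snr_ula_eps (M : nat) (A d Pbar r theta phi eps : R) : R :=
  snr_upa (occupation A d) Pbar (eps * r) (INR M * d) r theta phi.

Definition taylor1 (f : R -> R) (x0 x : R) : R :=
  f x0 + Derive f x0 * (x - x0).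

Definition alpha1 (M : nat) (d r theta : R) : R :=
  atan ((INR M * d / 2 - r * cos theta) / (r * sin theta)).
Definition alpha2 (M : nat) (d r theta : R) : R :=
  atan ((INR M * d / 2 + r * cos theta) / (r * sin theta)).

Definition Delta_span (M : nat) (d r theta : R) : R :=
  alpha1 M d r theta + alpha2 M d r theta.
Definition Delta_diff (M : nat) (d r theta : R) : R :=
  alpha1 M d r theta - alpha2 M d r theta.

Definition snr_ula_sines (M : nat) (A d Pbar r theta phi : R) : R :=
  Pbar * A * cos phi / (4 * PI * d * r * sin theta) *
  (sin (alpha1 M d r theta) + sin (alpha2 M d r theta)).

Definition snr_ula_angles (M : nat) (A d Pbar r theta phi : R) : R :=
  Pbar * A * cos phi / (2 * PI * d * r * sin theta) *
  (sin (Delta_span M d r theta / 2) * cos (Delta_diff M d r theta / 2)).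

(* Main.v *)
(** With [Psi], [Phi], [Omega] the direction cosines of the user, [h = d / (2 r)] and
    [k = M d / (2 r)], oddness of [U] in its first argument turns the bracket of the SNR
    into [g (Phi + h) - g (Phi - h)], where [g x = U (x, k - Omega) + U (x, k + Omega)].
    One computes [g' x = Psi * W (Psi^2 + x^2) k] with
    [W a k = ((k - Omega) / sqrt (a + (k - Omega)^2) + (k + Omega) / sqrt (a + (k + Omega)^2)) / a];
    at [x = Phi] one has [a = sin theta ^ 2] and the two quotients are the sines of
    [alpha1] and [alpha2], which gives the Taylor polynomial.

    For the relative error, uniform in [M], the mean value theorem replaces the difference by
    [2 h g' x] with [x] close to [Phi], and [W a k] is compared with [W b k]
    multiplicatively: [W a 0 = 0], and
    [dW/dk = (a + (k - Omega)^2)^(-3/2) + (a + (k + Omega)^2)^(-3/2)]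
    changes at most by the factor [mu^3] when [a] changes by the factor [mu^2]. *)

Require Import Defs.
From Stdlib Require Import Reals Lra.
From Coquelicot Require Import Coquelicot.
Open Scope R_scope.

(** * The quotients [y / sqrt (a + y ^ 2)] and their comparison for different [a] *)

Definition arm (a y : R) : R := y / sqrt (a + y ^ 2).

(** This is [W a k] of the overview, with [O] in the role of [Omega]. *)
Definition arms (a O k : R) : R := (arm a (k - O) + arm a (k + O)) / a.

(** The function [g] of the overview, with [P] and [O] in the roles of [Psi] and [Omega]. *)
Definition Upair (P O k x : R) : R := Ufun P x (k - O) + Ufun P x (k + O).

Lemma sqrt_shift_pos (a u : R) : 0 < a -> 0 < sqrt (a + u ^ 2).
Proof. intros Ha; apply sqrt_lt_R0; assert (H := pow2_ge_0 u); lra. Qed.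

Lemma is_derive_arm (a y : R) :
  0 < a -> is_derive (arm a) y (a / sqrt (a + y ^ 2) ^ 3).
Proof.
intros Ha.
assert (Hq : 0 < a + y ^ 2) by nra.
assert (Hs := sqrt_lt_R0 _ Hq).
assert (E := pow2_sqrt _ (Rlt_le _ _ Hq)).
unfold arm; auto_derive; replace (a + y * (y * 1)) with (a + y ^ 2) by ring.
- repeat split; lra.
- set (q := sqrt (a + y ^ 2)) in *.
  (* Eliminating [a] in favour of the root [q] turns the goal into a rational identity in [q] and
     [y]. *)
  replace a with (q ^ 2 - y ^ 2) by lra.
  field; lra.
Qed.

Lemma is_derive_arms (a O k : R) :
  0 < a ->
  is_derive (arms a O) k
    (/ sqrt (a + (k - O) ^ 2) ^ 3 + / sqrt (a + (k + O) ^ 2) ^ 3).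
Proof.
intros Ha.
assert (H1 := is_derive_arm a (k - O) Ha).
assert (H2 := is_derive_arm a (k + O) Ha).
assert (S1 : 0 < sqrt (a + (k - O) ^ 2)) by (apply sqrt_shift_pos; assumption).
assert (S2 : 0 < sqrt (a + (k + O) ^ 2)) by (apply sqrt_shift_pos; assumption).
unfold arms; auto_derive.
- split; [eexists; exact H1 | split; [eexists; exact H2 | exact I]].
- change ((1 * Derive (arm a) (k - O) + 1 * Derive (arm a) (k + O)) * / a =
    / sqrt (a + (k - O) ^ 2) ^ 3 + / sqrt (a + (k + O) ^ 2) ^ 3).
  rewrite (is_derive_unique _ _ _ H1), (is_derive_unique _ _ _ H2).
  field; lra.
Qed.

Lemma arms_0 (a O : R) : arms a O 0 = 0.
Proof.
unfold arms, arm.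
replace ((0 - O) ^ 2) with (O ^ 2) by ring.
replace ((0 + O) ^ 2) with (O ^ 2) by ring.
unfold Rdiv; ring.
Qed.

(** Since [1 <= mu], the term [u ^ 2] can be absorbed: [a + u ^ 2 <= mu ^ 2 * (b + u ^ 2)]. Taking
    roots and cubing gives the factor [mu ^ 3]. *)
Lemma sqrt_shift_cube_le (mu a b u : R) :
  0 < a -> 0 < b -> 1 <= mu -> a <= mu ^ 2 * b ->
  / sqrt (b + u ^ 2) ^ 3 <= mu ^ 3 * / sqrt (a + u ^ 2) ^ 3.
Proof.
intros Ha Hb Hmu Hab.
assert (Sa : 0 < sqrt (a + u ^ 2)) by (apply sqrt_shift_pos; assumption).
assert (Sb : 0 < sqrt (b + u ^ 2)) by (apply sqrt_shift_pos; assumption).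
assert (L : sqrt (a + u ^ 2) <= mu * sqrt (b + u ^ 2)).
{ rewrite <- (sqrt_pow2 mu) at 1 by lra.
  rewrite <- sqrt_mult_alt by apply pow2_ge_0.
  assert (0 <= (mu ^ 2 - 1) * u ^ 2) by (apply Rmult_le_pos; [nra | apply pow2_ge_0]).
  apply sqrt_le_1_alt; lra. }
apply (fun H => pow_incr _ _ 3 (conj (Rlt_le _ _ Sa) H)) in L.
rewrite Rpow_mult_distr in L.
assert (0 < sqrt (a + u ^ 2) ^ 3) by (apply pow_lt; lra).
assert (0 < sqrt (b + u ^ 2) ^ 3) by (apply pow_lt; lra).
apply (Rmult_le_reg_r (sqrt (a + u ^ 2) ^ 3 * sqrt (b + u ^ 2) ^ 3));
  [apply Rmult_lt_0_compat; assumption|].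
field_simplify; lra.
Qed.

(** The difference of the two sides vanishes at [k = 0] and has nonnegative derivative in [k] by
    [sqrt_shift_cube_le]. A termwise comparison would fail, because [k - O] and [k + O] may have
    opposite signs. *)
Lemma arms_le (mu a b O k : R) :
  0 < a -> 0 < b -> 1 <= mu -> a <= mu ^ 2 * b -> 0 <= k ->
  arms b O k <= mu ^ 3 * arms a O k.
Proof.
intros Ha Hb Hmu Hab Hk.
set (D := fun t => minus (scal (mu ^ 3) (arms a O t)) (arms b O t)).
set (D' := fun t => minus
  (scal (mu ^ 3) (/ sqrt (a + (t - O) ^ 2) ^ 3 + / sqrt (a + (t + O) ^ 2) ^ 3))
  (/ sqrt (b + (t - O) ^ 2) ^ 3 + / sqrt (b + (t + O) ^ 2) ^ 3)).
assert (HD : forall t, is_derive D t (D' t)).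
{ intros t; apply (is_derive_minus (V := R_NormedModule)).
  - apply is_derive_scal, is_derive_arms, Ha.
  - apply is_derive_arms, Hb. }
destruct (MVT_gen D 0 k D') as [c [_ Hc]].
- intros; apply HD.
- intros x _; apply continuity_pt_filterlim, (ex_derive_continuous D).
  eexists; apply HD.
- assert (0 <= D' c).
  { assert (H1 := sqrt_shift_cube_le mu a b (c - O) Ha Hb Hmu Hab).
    assert (H2 := sqrt_shift_cube_le mu a b (c + O) Ha Hb Hmu Hab).
    unfold D', minus, plus, opp, scal; simpl; unfold mult; simpl in *; lra. }
  assert (E : D k - D 0 = mu ^ 3 * arms a O k - arms b O k).
  { unfold D; rewrite 2 arms_0; unfold minus, plus, opp, scal; simpl; unfold mult; simpl; ring. }
  nra.
Qed.

Lemma arms_ge0 (a O k : R) : 0 < a -> 0 <= k -> 0 <= arms a O k.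
Proof.
intros Ha Hk.
destruct (MVT_gen (arms a O) 0 k (fun t =>
  / sqrt (a + (t - O) ^ 2) ^ 3 + / sqrt (a + (t + O) ^ 2) ^ 3)) as [c [_ Hc]].
- intros; apply is_derive_arms, Ha.
- intros x _; apply continuity_pt_filterlim, (ex_derive_continuous (arms a O)).
  eexists; apply is_derive_arms, Ha.
- rewrite arms_0 in Hc.
  assert (0 < / sqrt (a + (c - O) ^ 2) ^ 3)
    by (apply Rinv_0_lt_compat, pow_lt, sqrt_shift_pos, Ha).
  assert (0 < / sqrt (a + (c + O) ^ 2) ^ 3)
    by (apply Rinv_0_lt_compat, pow_lt, sqrt_shift_pos, Ha).
  nra.
Qed.

(** * Derivatives of the arctangent terms *)

Lemma is_derive_Ufun (P x y : R) :
  0 < P ->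
  is_derive (fun t => Ufun P t y) x (P * (arm (P ^ 2 + x ^ 2) y / (P ^ 2 + x ^ 2))).
Proof.
intros HP.
assert (Hq : 0 < P ^ 2 + x ^ 2 + y ^ 2) by nra.
assert (Hs := sqrt_lt_R0 _ Hq).
assert (E := pow2_sqrt _ (Rlt_le _ _ Hq)).
unfold Ufun, arm; auto_derive;
  replace (P * (P * 1) + x * (x * 1) + y * (y * 1)) with (P ^ 2 + x ^ 2 + y ^ 2) by ring.
- repeat split; nra.
- set (q := sqrt (P ^ 2 + x ^ 2 + y ^ 2)) in *.
  assert (Hx : P ^ 2 + x ^ 2 <> 0) by nra.
  assert (Hy : P ^ 2 + y ^ 2 <> 0) by nra.
  (* This factorises the denominator produced by the arctangent; its factor [P ^ 2 + y ^ 2] equals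
     [q ^ 2 - x ^ 2] and cancels against the numerator. *)
  assert (Hd : P ^ 2 * q ^ 2 + x ^ 2 * y ^ 2 = (P ^ 2 + x ^ 2) * (P ^ 2 + y ^ 2))
    by (rewrite E; ring).
  transitivity (P * y * (q ^ 2 - x ^ 2) / (q * (P ^ 2 * q ^ 2 + x ^ 2 * y ^ 2))).
  + field.
    assert (P ^ 2 * q ^ 2 + x ^ 2 * y ^ 2 <> 0)
      by (rewrite Hd; apply Rmult_integral_contrapositive_currified; assumption).
    repeat split; nra.
  + rewrite Hd; replace (q ^ 2 - x ^ 2) with (P ^ 2 + y ^ 2) by lra.
    field; repeat split; lra.
Qed.

Lemma is_derive_Upair (P O k x : R) :
  0 < P -> is_derive (Upair P O k) x (P * arms (P ^ 2 + x ^ 2) O k).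
Proof.
intros HP.
assert (H := is_derive_plus (V := R_NormedModule) _ _ _ _ _
  (is_derive_Ufun P x (k - O) HP) (is_derive_Ufun P x (k + O) HP)).
unfold Upair.
replace (P * arms (P ^ 2 + x ^ 2) O k) with
  (plus (P * (arm (P ^ 2 + x ^ 2) (k - O) / (P ^ 2 + x ^ 2)))
        (P * (arm (P ^ 2 + x ^ 2) (k + O) / (P ^ 2 + x ^ 2)))); [exact H|].
unfold arms, plus; simpl; unfold Rdiv; ring.
Qed.

Lemma Ufun_opp (P x y : R) : Ufun P (- x) y = - Ufun P x y.
Proof.
unfold Ufun; rewrite <- atan_opp; f_equal.
replace ((- x) ^ 2) with (x ^ 2) by ring.
unfold Rdiv; ring.
Qed.

(** * The linear-array SNR: difference form, sine form and first-order expansion *)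

Lemma snr_ula_eps_Upair (M : nat) (A d Pbar r theta phi eps : R) :
  r <> 0 ->
  let g := Upair (dirPsi theta phi) (dirOmega theta) (INR M * d / (2 * r)) in
  snr_ula_eps M A d Pbar r theta phi eps =
  occupation A d * Pbar / (4 * PI) *
  (g (dirPhi theta phi + eps / 2) - g (dirPhi theta phi - eps / 2)).
Proof.
intros Hr g; unfold snr_ula_eps, snr_upa, g, Upair; cbv zeta; f_equal.
replace (eps * r / (2 * r)) with (eps / 2) by (field; exact Hr).
replace (eps / 2 - dirPhi theta phi) with (- (dirPhi theta phi - eps / 2)) by ring.
rewrite 2 Ufun_opp, (Rplus_comm (eps / 2)); ring.
Qed.

Lemma snr_ula_snr_ula_eps (M : nat) (A d Pbar r theta phi : R) :
  r <> 0 -> snr_ula M A d Pbar r theta phi = snr_ula_eps M A d Pbar r theta phi (d / r).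
Proof.
intros Hr; unfold snr_ula, snr_ula_eps; f_equal; field; exact Hr.
Qed.

Lemma sin_atan_arm (s y : R) : 0 < s -> sin (atan (y / s)) = arm (s ^ 2) y.
Proof.
intros Hs.
assert (0 < sqrt (s ^ 2 + y ^ 2)) by (apply sqrt_shift_pos, pow_lt, Hs).
rewrite sin_atan; unfold arm, Rsqr.
(* Factoring [s ^ 2] out of the radicand exposes the root [sqrt (1 + (y / s) ^ 2)] of the formula
   for [sin (atan _)]. *)
replace (s ^ 2 + y ^ 2) with (s ^ 2 * (1 + y / s * (y / s))) in * by (field; lra).
rewrite sqrt_mult_alt, sqrt_pow2 in * by nra.
field; split; nra.
Qed.

Lemma snr_ula_sines_arms (M : nat) (A d Pbar r theta phi : R) :
  0 < r -> 0 < d -> 0 < sin theta ->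
  snr_ula_sines M A d Pbar r theta phi =
  occupation A d * Pbar / (4 * PI) *
  (d / r * (dirPsi theta phi *
    arms (sin theta ^ 2) (dirOmega theta) (INR M * d / (2 * r)))).
Proof.
intros Hr Hd Hs.
unfold snr_ula_sines, alpha1, alpha2, arms, dirOmega.
replace ((INR M * d / 2 - r * cos theta) / (r * sin theta))
  with ((INR M * d / (2 * r) - cos theta) / sin theta) by (field; lra).
replace ((INR M * d / 2 + r * cos theta) / (r * sin theta))
  with ((INR M * d / (2 * r) + cos theta) / sin theta) by (field; lra).
rewrite 2 sin_atan_arm by exact Hs.
assert (HPI := PI_RGT_0).
unfold occupation, dirPsi; field; lra.
Qed.

Lemma snr_ula_sines_angles (M : nat) (A d Pbar r theta phi : R) :
  0 < r -> 0 < d -> 0 < sin theta ->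
  snr_ula_sines M A d Pbar r theta phi = snr_ula_angles M A d Pbar r theta phi.
Proof.
intros Hr Hd Hs.
assert (HPI := PI_RGT_0).
unfold snr_ula_sines, snr_ula_angles, Delta_span, Delta_diff.
rewrite form3; field; lra.
Qed.

Lemma dirPsi2_dirPhi2 (theta phi : R) :
  dirPsi theta phi ^ 2 + dirPhi theta phi ^ 2 = sin theta ^ 2.
Proof.
unfold dirPsi, dirPhi; assert (H := sin2_cos2 phi); unfold Rsqr in H.
replace ((sin theta * cos phi) ^ 2 + (sin theta * sin phi) ^ 2)
  with (sin theta ^ 2 * (sin phi * sin phi + cos phi * cos phi)) by ring.
rewrite H; ring.
Qed.

Lemma is_derive_snr_ula_eps (M : nat) (A d Pbar r theta phi : R) :
  r <> 0 -> 0 < dirPsi theta phi ->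
  is_derive (snr_ula_eps M A d Pbar r theta phi) 0
    (occupation A d * Pbar / (4 * PI) * (dirPsi theta phi *
       arms (sin theta ^ 2) (dirOmega theta) (INR M * d / (2 * r)))).
Proof.
intros Hr HP.
eapply is_derive_ext.
{ intros t; symmetry; apply snr_ula_eps_Upair, Hr. }
apply is_derive_scal.
set (P := dirPsi theta phi) in *; set (F := dirPhi theta phi).
set (g := Upair P (dirOmega theta) (INR M * d / (2 * r))).
set (l := P * arms (sin theta ^ 2) (dirOmega theta) (INR M * d / (2 * r))).
assert (Hg : is_derive g F l).
{ unfold l; rewrite <- (dirPsi2_dirPhi2 theta phi); apply is_derive_Upair, HP. }
(* At [eps = 0] both evaluation points coincide with [F], so each contributes [l / 2] to the
   derivative. *)
assert (Hp : is_derive g (F + 0 / 2) l) by (replace (F + 0 / 2) with F by field; exact Hg).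
assert (Hm : is_derive g (F - 0 / 2) l) by (replace (F - 0 / 2) with F by field; exact Hg).
auto_derive.
- split; [eexists; exact Hp | split; [eexists; exact Hm | exact I]].
- change (1 * / 2 * Derive g (F + 0 / 2) + - (- (1 * / 2) * Derive g (F - 0 / 2)) = l).
  rewrite (is_derive_unique _ _ _ Hp), (is_derive_unique _ _ _ Hm).
  field.
Qed.

Lemma taylor1_snr_ula_eps (M : nat) (A d Pbar r theta phi : R) :
  0 < r -> 0 < d -> 0 < sin theta -> 0 < dirPsi theta phi ->
  taylor1 (snr_ula_eps M A d Pbar r theta phi) 0 (d / r) =
  snr_ula_sines M A d Pbar r theta phi.
Proof.
intros Hr Hd Hs HP.
unfold taylor1.
rewrite (is_derive_unique _ _ _ (is_derive_snr_ula_eps M A d Pbar r theta phi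
  (Rgt_not_eq _ _ Hr) HP)).
rewrite snr_ula_eps_Upair, snr_ula_sines_arms by lra.
(* The zeroth-order term is a difference of two equal values of [Upair], so only the linear term
   survives. *)
replace (0 / 2) with 0 by field.
rewrite Rplus_0_r, Rminus_0_r; ring.
Qed.

(** * Relative error, uniform in the number of elements *)

Lemma arms_perturbation (t P F x O k : R) :
  0 < t <= 1 -> 0 < P -> Rabs F <= 1 -> 0 <= k ->
  Rabs (x - F) <= 1 -> 3 * Rabs (x - F) <= t * P ^ 2 ->
  Rabs (arms (P ^ 2 + x ^ 2) O k - arms (P ^ 2 + F ^ 2) O k)
    <= 7 * t * arms (P ^ 2 + F ^ 2) O k.
Proof.
intros Ht HP HF Hk Hx1 Hx.
assert (Hsq : Rabs (x ^ 2 - F ^ 2) <= t * P ^ 2).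
{ replace (x ^ 2 - F ^ 2) with ((x - F) * ((x - F) + 2 * F)) by ring.
  rewrite Rabs_mult.
  (* The source of the constant 3 in the hypothesis: [1] from [x - F] and [2] from [2 * F]. *)
  assert (Rabs ((x - F) + 2 * F) <= 3).
  { eapply Rle_trans; [apply Rabs_triang|].
    rewrite Rabs_mult, (Rabs_pos_eq 2) by lra; lra. }
  assert (H0 := Rabs_pos (x - F)); nra. }
apply Rabs_le_between in Hsq.
assert (Ha : 0 < P ^ 2 + x ^ 2) by nra.
assert (Hb : 0 < P ^ 2 + F ^ 2) by nra.
assert (Hmu : (1 + t) ^ 2 >= 1 + t) by nra.
assert (Hx2 := pow2_ge_0 x).
assert (HF2 := pow2_ge_0 F).
assert (HP2 := pow2_ge_0 P).
(* Both parameters are at least [P ^ 2] and differ by at most [t * P ^ 2], so each is at most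
   [1 + t <= (1 + t) ^ 2] times the other. Thus [arms_le] applies in both directions with
   [mu = 1 + t]. *)
assert (H1 : arms (P ^ 2 + x ^ 2) O k <= (1 + t) ^ 3 * arms (P ^ 2 + F ^ 2) O k).
{ apply arms_le; try lra; nra. }
assert (H2 : arms (P ^ 2 + F ^ 2) O k <= (1 + t) ^ 3 * arms (P ^ 2 + x ^ 2) O k).
{ apply arms_le; try lra; nra. }
assert (H3 : 0 <= arms (P ^ 2 + F ^ 2) O k) by (apply arms_ge0; assumption).
assert (H4 : 0 <= arms (P ^ 2 + x ^ 2) O k) by (apply arms_ge0; assumption).
set (a := arms (P ^ 2 + x ^ 2) O k) in *; set (b := arms (P ^ 2 + F ^ 2) O k) in *.
(* The constant 7 is [3 + 3 + 1], from expanding the cube with [t <= 1]. *)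
assert (H5 : 1 <= (1 + t) ^ 3 <= 1 + 7 * t) by (split; nra).
set (m := (1 + t) ^ 3) in *.
apply Rabs_le_between; split; [|nra].
(* If [a <= b], then [b - a <= (m - 1) * a <= 7 * t * b]; otherwise the lower bound is immediate. *)
destruct (Rle_lt_dec a b); [|nra].
nra.
Qed.

Lemma snr_ula_relative_error (t : R) (M : nat) (A d Pbar r theta phi : R) :
  0 < t <= 1 -> 0 < A -> 0 < d -> 0 < Pbar -> 0 < r ->
  0 < sin theta -> 0 < dirPsi theta phi ->
  d / r <= 1 -> 3 * (d / r) <= t * dirPsi theta phi ^ 2 ->
  Rabs (snr_ula M A d Pbar r theta phi - snr_ula_sines M A d Pbar r theta phi)
    <= 7 * t * snr_ula_sines M A d Pbar r theta phi.
Proof.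
intros Ht HA Hd HPb Hr Hs HP Hd1 Hd3.
rewrite snr_ula_snr_ula_eps, snr_ula_eps_Upair, snr_ula_sines_arms by lra.
rewrite <- (dirPsi2_dirPhi2 theta phi).
assert (He : 0 < d / r) by (apply Rdiv_lt_0_compat; lra).
assert (Hk : 0 <= INR M * d / (2 * r)).
{ apply Rdiv_le_0_compat; [apply Rmult_le_pos; [apply pos_INR | lra] | lra]. }
assert (HF : Rabs (dirPhi theta phi) <= 1).
{ assert (H1 := dirPsi2_dirPhi2 theta phi).
  assert (H2 := SIN_bound theta).
  apply Rabs_le_between; nra. }
set (e := d / r) in *; set (k := INR M * d / (2 * r)) in *.
set (P := dirPsi theta phi) in *; set (F := dirPhi theta phi) in *.
set (O := dirOmega theta).
assert (HC : 0 < occupation A d * Pbar / (4 * PI)).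
{ assert (HPI := PI_RGT_0).
  apply Rdiv_lt_0_compat; [apply Rmult_lt_0_compat|]; try lra.
  apply Rdiv_lt_0_compat; [lra | apply pow_lt; lra]. }
set (C := occupation A d * Pbar / (4 * PI)) in *.
destruct (MVT_gen (Upair P O k) (F - e / 2) (F + e / 2)
  (fun x => P * arms (P ^ 2 + x ^ 2) O k)) as [c [Hc Ec]].
- intros; apply is_derive_Upair, HP.
- intros x _; apply continuity_pt_filterlim, (ex_derive_continuous (Upair P O k)).
  eexists; apply is_derive_Upair, HP.
- rewrite Rmin_left, Rmax_right in Hc by lra.
  assert (Hcf : Rabs (c - F) <= e) by (apply Rabs_le_between; lra).
  assert (Hp := arms_perturbation t P F c O k Ht HP HF Hk ltac:(lra) ltac:(lra)).
  rewrite Ec.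
  replace (C * (P * arms (P ^ 2 + c ^ 2) O k * (F + e / 2 - (F - e / 2))) -
     C * (e * (P * arms (P ^ 2 + F ^ 2) O k)))
    with (C * e * P * (arms (P ^ 2 + c ^ 2) O k - arms (P ^ 2 + F ^ 2) O k)) by field.
  assert (HK : 0 < C * e * P) by (apply Rmult_lt_0_compat; [apply Rmult_lt_0_compat|]; assumption).
  rewrite Rabs_mult, (Rabs_pos_eq (C * e * P)) by lra.
  apply (Rmult_le_compat_l _ _ _ (Rlt_le _ _ HK)) in Hp.
  eapply Rle_trans; [exact Hp|].
  apply Req_le; ring.
Qed.

Theorem lemma6 :
  forall theta phi : R,
  0 <= theta <= PI -> theta <> 0 -> theta <> PI ->
  - (PI / 2) <= phi <= PI / 2 -> phi <> PI / 2 -> phi <> - (PI / 2) ->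
  (forall (M : nat) (A d Pbar r : R),
     (1 <= M)%nat -> 0 < A -> 0 < d -> occupation A d <= 1 ->
     0 < Pbar -> 0 < r ->
     ex_derive (snr_ula_eps M A d Pbar r theta phi) 0 /\
     taylor1 (snr_ula_eps M A d Pbar r theta phi) 0 (d / r)
       = snr_ula_sines M A d Pbar r theta phi /\
     snr_ula_sines M A d Pbar r theta phi
       = snr_ula_angles M A d Pbar r theta phi) /\
  (forall eta : R, 0 < eta ->
     exists delta : R, 0 < delta /\
     forall (M : nat) (A d Pbar r : R),
       (1 <= M)%nat -> 0 < A -> 0 < d -> occupation A d <= 1 ->
       0 < Pbar -> 0 < r ->
       d / r < delta ->
       Rabs (snr_ula M A d Pbar r theta phi
             - snr_ula_sines M A d Pbar r theta phi)
         <= eta * snr_ula_sines M A d Pbar r theta phi).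
Proof.
intros theta phi Ht Ht0 HtPI Hf Hf1 Hf2.
assert (Hs : 0 < sin theta) by (apply sin_gt_0; lra).
assert (HP : 0 < dirPsi theta phi).
{ apply Rmult_lt_0_compat; [exact Hs | apply cos_gt_0; lra]. }
split.
- intros M A d Pbar r HM HA Hd Ho HPb Hr; repeat split.
  + eexists; apply is_derive_snr_ula_eps; lra.
  + apply taylor1_snr_ula_eps; assumption.
  + apply snr_ula_sines_angles; assumption.
- intros eta Heta.
  (* Chosen so that [7 * t <= eta], with [t <= 1] for the cube estimate. *)
  set (t := Rmin 1 (eta / 7)).
  assert (Ht1 : 0 < t) by (apply Rmin_glb_lt; lra).
  assert (Ht2 := Rmin_l 1 (eta / 7)); assert (Ht3 := Rmin_r 1 (eta / 7)); fold t in Ht2, Ht3.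
  assert (HP2 : 0 < t * dirPsi theta phi ^ 2).
  { apply Rmult_lt_0_compat; [lra | apply pow_lt, HP]. }
  (* The two entries ensure the two smallness conditions on [d / r] in [snr_ula_relative_error];
     they depend on [eta] and the angles only, hence not on [M]. *)
  exists (Rmin 1 (t * dirPsi theta phi ^ 2 / 3)); split; [apply Rmin_glb_lt; lra|].
  intros M A d Pbar r HM HA Hd Ho HPb Hr Hdr.
  assert (H1 := Rmin_l 1 (t * dirPsi theta phi ^ 2 / 3)).
  assert (H2 := Rmin_r 1 (t * dirPsi theta phi ^ 2 / 3)).
  assert (H := snr_ula_relative_error t M A d Pbar r theta phi
    ltac:(lra) HA Hd HPb Hr Hs HP ltac:(lra) ltac:(lra)).
  (* Nonnegativity of the sine form is read off the error bound itself. *)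
  assert (H0 := Rle_trans _ _ _ (Rabs_pos _) H).
  nra.
Qed.
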